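(* Let $p,q$ be distinct primes, $n,m$ positive integers, $G=\mathrm{El}(p^n)\times\mathrm{El}(q^m)$, $\alpha=\frac{p^n-1}{p-1}$, $\beta=\frac{q^m-1}{q-1}$. Let \[ T^D_1=\begin{bmatrix} 0& p^n-1 & (p^n-1)(q^m-1) & q^m-1\\ 1& 2p^n-p-2 & (2p^n-p-1)(q^m-1) & 2(q^m-1)\\ 1& 2p^n-p-1 & 2(p^n-1)(q^m-1)-(p-1)(q-1)-1 & 2q^m-q-1\\ 1& 2(p^n-1) & (p^n-1)(2q^m-q-1) & 2q^m-q-2 \end{bmatrix}. \] Then the characteristic polynomial of the distance matrix of the power graph $\mathcal{P}(G)$ is \[ \phi_D(\mathcal{P}(G),x)=\phi(T^D_1,x)\,(x+1)^{p^nq^m-(\alpha+1)(\beta+1)}\,(x+(p-1)(q-1)+1)^{(\alpha-1)(\beta-1)} f(x)^{\alpha-1}g(x)^{\beta-1}, \] where $f(x)$ and $g(x)$ are the characteristic polynomials of $\begin{bmatrix} -p & (1-p)(q^m-1)\\ 1-p & (1-p)(q-1)-1\end{bmatrix}$ and $\begin{bmatrix}(p-1)(1-q)-1 & 1-q\\ (p^n-1)(1-q) & -q\end{bmatrix}$, respectively.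
   Context: $\mathrm{El}(p^n)$ denotes the elementary abelian group of order $p^n$. For a group $G$, the power graph $\mathcal{P}(G)$ is the simple graph with vertex set $G$ in which distinct $a,b$ are adjacent if and only if $a=b^k$ or $b=a^k$ for some positive integer $k$. The distance matrix of a connected graph has $(u,v)$-entry equal to the graph distance $d(u,v)$ (and $0$ on the diagonal). $\phi(B,x)=\det(xI-B)$ and $\phi_D(\Gamma,x)$ is the characteristic polynomial of the distance matrix of $\Gamma$. *)

(* Defs.v *)
From HB Require Import structures.
From mathcomp Require Import all_boot all_order all_algebra all_fingroup all_solvable.

Set Implicit Arguments.
Unset Strict Implicit.
Unset Printing Implicit Defensive.

Import Order.TTheory GRing.Theory Num.Theory.
Local Open Scope ring_scope.

Section Graph.
Variables (V : finType) (e : rel V).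

Definition has_walk (u v : V) (k : nat) : bool :=
  [exists w : k.-tuple V, path e u w && (last u w == v)].

(* Position i of iota 0 #|V| holds i, so this is the least length of a walk
   from u to v; it is #|V| when u and v are not connected. *)
Definition gdist (u v : V) : nat := find (has_walk u v) (iota 0 #|V|).

Lemma has_walkP u v k :
  reflect (exists w, [/\ path e u w, last u w = v & size w = k])
          (has_walk u v k).
Proof.
apply: (iffP existsP) => [[w /andP[pw /eqP lw]]|[w [pw lw /eqP sw]]].
  by exists w; rewrite size_tuple.
by exists (Tuple sw); rewrite /= pw lw eqxx.
Qed.

Lemma gdist_le u w : path e u w -> (gdist u (last u w) <= size w)%N.
Proof.
move=> pw; rewrite leqNgt; apply/negP => lt_wd.
have ltV : (size w < #|V|)%N.
  by rewrite (leq_trans lt_wd)// -[leqRHS](size_iota 0) find_size.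
have := before_find 0%N lt_wd; rewrite nth_iota// add0n => /has_walkP; apply.
by exists w.
Qed.

Lemma gdist_walk u v : connect e u v -> has_walk u v (gdist u v).
Proof.
move=> /connectP[w0 /shortenP[w pw uw _] ->].
have ltV : (size w < #|V|)%N by rewrite -[(_ < _)%N]/(size (u :: w) <= #|V|)%N
  -(card_uniqP uw) max_card.
have hw : has (has_walk u (last u w)) (iota 0 #|V|).
  apply/hasP; exists (size w); first by rewrite mem_iota.
  by apply/has_walkP; exists w.
have := nth_find 0%N hw; rewrite nth_iota ?add0n//.
by rewrite -[ltnRHS](size_iota 0) -has_find.
Qed.

Definition distance_mx : 'M[int]_#|V| :=
  \matrix_(i, j) (gdist (enum_val i) (enum_val j))%:Z.

End Graph.

(* Powers of b repeat with period #[b] <= #|gT|, so exponents 1 .. #|gT| are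
   enough; see power_graphP. *)
Definition power_graph (gT : finGroupType) : rel gT := fun a b =>
  (a != b) && [exists k : 'I_#|gT|, (a == b ^+ k.+1)%g || (b == a ^+ k.+1)%g].

Lemma power_graphP (gT : finGroupType) (a b : gT) :
  reflect
    (a <> b /\ exists k : nat, (0 < k)%N /\ (a = b ^+ k \/ b = a ^+ k)%g)
    (power_graph a b).
Proof.
have red (x y : gT) k : (0 < k)%N -> x = (y ^+ k)%g ->
    exists i : 'I_#|gT|, x = (y ^+ i.+1)%g.
  move=> k0 ->; have lt_i : (k.-1 %% #[y]%g < #|gT|)%N.
    by rewrite (leq_trans (ltn_pmod _ (order_gt0 y)))// max_card.
  by exists (Ordinal lt_i); rewrite /= expgS expg_mod_order -expgS prednK.
apply: (iffP andP) => [[/eqP ab /existsP[k /orP kP]]|[/eqP ab [k [k0 kP]]]].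
  by split=> //; exists k.+1; split=> //; case: kP => /eqP; [left|right].
split=> //; apply/existsP; case: kP => /red[]// i /eqP iP; exists i.
  by rewrite iP.
by rewrite iP orbT.
Qed.

Lemma power_graph_sym (gT : finGroupType) : symmetric (@power_graph gT).
Proof.
move=> a b; rewrite /power_graph eq_sym; congr (_ && _).
by apply: eq_existsb => k; rewrite orbC.
Qed.

Lemma power_graph_connected (gT : finGroupType) (a b : gT) :
  connect (@power_graph gT) a b.
Proof.
have c1 (x : gT) : connect (@power_graph gT) x 1%g.
  have [->|x1] := eqVneq x 1%g; first exact: connect0.
  apply/connect1/power_graphP; split; first exact/eqP.
  by exists #[x]%g; split; [exact: order_gt0 | right; rewrite expg_order].
apply: connect_trans (c1 a) _.
by rewrite (sym_connect_sym (@power_graph_sym gT)) c1.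
Qed.

Definition is_El (p n : nat) (gT : finGroupType) : Prop :=
  (p.-abelem [set: gT])%g /\ #|gT| = (p ^ n)%N.

Definition mx_of_rows (r c : nat) (rows : seq (seq int)) : 'M[int]_(r, c) :=
  \matrix_(i, j) nth 0 (nth [::] rows i) j.

Section Matrices.
Variables (p q n m : nat).
Let P : int := p%:Z.
Let Q : int := q%:Z.
Let Pn : int := P ^+ n.
Let Qm : int := Q ^+ m.

Definition T1D : 'M[int]_4 := mx_of_rows 4 4
  [:: [:: 0; Pn - 1; (Pn - 1) * (Qm - 1); Qm - 1];
      [:: 1; 2 * Pn - P - 2; (2 * Pn - P - 1) * (Qm - 1); 2 * (Qm - 1)];
      [:: 1; 2 * Pn - P - 1;
          2 * (Pn - 1) * (Qm - 1) - (P - 1) * (Q - 1) - 1; 2 * Qm - Q - 1];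
      [:: 1; 2 * (Pn - 1); (Pn - 1) * (2 * Qm - Q - 1); 2 * Qm - Q - 2]].

Definition fmx : 'M[int]_2 := mx_of_rows 2 2
  [:: [:: - P; (1 - P) * (Qm - 1)];
      [:: 1 - P; (1 - P) * (Q - 1) - 1]].

Definition gmx : 'M[int]_2 := mx_of_rows 2 2
  [:: [:: (P - 1) * (1 - Q) - 1; 1 - Q];
      [:: (Pn - 1) * (1 - Q); - Q]].

End Matrices.

(* Main.v *)
(* The distance between two elements of the power graph depends only on the
   cyclic subgroups that they generate: it is 1 if these are comparable and 2
   otherwise (0 on the diagonal). Hence each determinant below has many
   interchangeable indices. If a partition of the index set is equitable, the
   vectors that are constant on its blocks form an invariant subspace, and the
   determinant splits as the determinant of the quotient times that of the
   complement. Doing this three times, for generators of the same cyclic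
   subgroup, for the subgroups of order p and for those of order q, splits off
   x + 1, f and x + (p-1)(q-1) + 1, and g, and leaves T1D. *)

Require Import Defs.
From mathcomp Require Import all_boot all_order all_algebra all_fingroup all_solvable.
From mathcomp Require Import ring.

Set Implicit Arguments.
Unset Strict Implicit.
Unset Printing Implicit Defensive.

Import GRing.Theory.
Local Open Scope ring_scope.

(** * Determinants indexed by finite types, and their splitting along partitions *)

Section FinDet.
Variable R : comNzRingType.

(** Rows and columns follow the same enumeration, so its choice does not affect the value and index
    sets may be changed along any bijection. *)
Definition fdet (T : finType) (F : T -> T -> R) : R :=
  \det (\matrix_(i < #|T|, j < #|T|) F (enum_val i) (enum_val j)).

(** The two matrices are conjugate by a permutation matrix, and the two signs cancel. *)
Lemma det_relabel n (T : Type) (g h : 'I_n -> T) (F : T -> T -> R) :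
  bijective g -> bijective h ->
  \det (\matrix_(i, j) F (g i) (g j)) = \det (\matrix_(i, j) F (h i) (h j)).
Proof.
move=> [g' gK g'K] [h' hK h'K].
have inj : injective (g' \o h) by move=> i j /(can_inj g'K)/(can_inj hK).
pose s := perm inj.
have -> : \matrix_(i, j) F (h i) (h j) =
    perm_mx s *m (\matrix_(i, j) F (g i) (g j)) *m perm_mx s^-1.
  rewrite -row_permE -col_permE; apply/matrixP => i j.
  by rewrite !mxE !permE /= !g'K.
by rewrite !det_mulmx !det_perm mulrAC -signr_addb odd_permV addbb mul1r.
Qed.

Lemma fdet_ord (T : finType) n (h : 'I_n -> T) (F : T -> T -> R) :
  bijective h -> fdet F = \det (\matrix_(i, j) F (h i) (h j)).
Proof.
move=> bij_h; have eq_n : n = #|T| by rewrite -(bij_eq_card bij_h) card_ord.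
have := @enum_val_bij T; rewrite /fdet.
move: (@enum_val T _) => e; move: #|_| e eq_n => k e eq_n bij_e.
by case: _ / eq_n e bij_e => e bij_e; apply: det_relabel.
Qed.

Lemma eq_fdet (T : finType) (F F' : T -> T -> R) :
  (forall x y, F x y = F' x y) -> fdet F = fdet F'.
Proof. by move=> eqF; congr (\det _); apply/matrixP => i j; rewrite !mxE. Qed.

Lemma fdet_reindex (S T : finType) (h : S -> T) (F : T -> T -> R) :
  bijective h -> fdet F = fdet (fun x y => F (h x) (h y)).
Proof.
by move=> bij_h; rewrite (fdet_ord _ (bij_comp bij_h (@enum_val_bij S))).
Qed.

Lemma fdet_scalar (T : finType) (c : R) :
  fdet (fun x y : T => c *+ (x == y)) = c ^+ #|T|.
Proof.
rewrite /fdet -det_scalar; congr (\det _); apply/matrixP => i j.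
by rewrite !mxE (inj_eq enum_val_inj).
Qed.

Definition sum_ord_val (C E : finType) (i : 'I_(#|C| + #|E|)) : C + E :=
  match split i with
  | inl j => inl (enum_val j)
  | inr j => inr (enum_val j)
  end.

Lemma sum_ord_val_bij (C E : finType) : bijective (@sum_ord_val C E).
Proof.
exists (fun x => unsplit (match x with
  | inl c => inl (enum_rank c) | inr e => inr (enum_rank e) end)) => [i|x].
  by rewrite /sum_ord_val -[RHS]splitK; case: (split i) => j; rewrite enum_valK.
by rewrite /sum_ord_val unsplitK; case: x => x; rewrite enum_rankK.
Qed.

Lemma fdet_sum (C E : finType) (F : C + E -> C + E -> R) :
  fdet F = \det (block_mx
    (\matrix_(i < #|C|, j < #|C|) F (inl (enum_val i)) (inl (enum_val j)))
    (\matrix_(i < #|C|, j < #|E|) F (inl (enum_val i)) (inr (enum_val j)))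
    (\matrix_(i < #|E|, j < #|C|) F (inr (enum_val i)) (inl (enum_val j)))
    (\matrix_(i < #|E|, j < #|E|) F (inr (enum_val i)) (inr (enum_val j)))).
Proof.
rewrite (fdet_ord _ (sum_ord_val_bij C E)); congr (\det _).
apply/matrixP => i j; rewrite [LHS]mxE /sum_ord_val.
by case: split_ordP => i' ->; case: split_ordP => j' ->;
  rewrite ?block_mxEul ?block_mxEur ?block_mxEdl ?block_mxEdr mxE.
Qed.

(* The hypothesis says that the columns of [1; V] span an invariant subspace. *)
Lemma det_block_invariant c e (X : 'M[R]_c) (Y : 'M[R]_(c, e))
    (Z V : 'M[R]_(e, c)) (W : 'M[R]_e) :
  Z + W *m V = V *m (X + Y *m V) ->
  \det (block_mx X Y Z W) = \det (X + Y *m V) * \det (W - V *m Y).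
Proof.
move=> inv; rewrite -(det_ublock _ Y).
(* After conjugation by a unipotent matrix the lower left block is Z + W V - V (X + Y V), which
   vanishes by [inv]. *)
have -> : block_mx (X + Y *m V) Y 0 (W - V *m Y) =
    block_mx 1%:M 0 (- V) 1%:M *m block_mx X Y Z W *m block_mx 1%:M 0 V 1%:M.
  rewrite !mulmx_block !mul1mx !mul0mx !mulmx1 !mulmx0 !addr0 !add0r.
  congr block_mx; last by rewrite mulNmx addrC.
  by rewrite mulmxDl !mulNmx -mulmxA addrACA inv mulmxDr -opprD addNr.
by rewrite !det_mulmx !det_lblock !det1 !mul1r mulr1.
Qed.

(* [E] lists the points that are not the chosen representative of their class;
   the hypothesis says that the partition by [s] is equitable. *)
Lemma fdet_quotient (C E : finType) (s : E -> C) (F : C + E -> C + E -> R) :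
  (forall e c, F (inr e) (inl c) + \sum_(e' | s e' == c) F (inr e) (inr e') =
     F (inl (s e)) (inl c) + \sum_(e' | s e' == c) F (inl (s e)) (inr e')) ->
  fdet F =
    fdet (fun c c' => F (inl c) (inl c')
                      + \sum_(e | s e == c') F (inl c) (inr e))
    * fdet (fun e e' => F (inr e) (inr e') - F (inl (s e)) (inr e')).
Proof.
move=> inv; rewrite fdet_sum.
(* [V] is the incidence matrix of [s]: multiplying by it on the right sums over classes, on the left
   it copies the row of the representative. *)
pose V : 'M[R]_(#|E|, #|C|) :=
  \matrix_(i, j) (s (enum_val i) == enum_val j)%:R.
have mulV m (G : 'I_m -> E -> R) i j :
    ((\matrix_(i, k) G i (enum_val k)) *m V) i j =
    \sum_(e | s e == enum_val j) G i e.
  rewrite mxE [RHS]big_mkcond /= [RHS](reindex (@enum_val E E)) /=; last first.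
    exact/onW_bij/enum_val_bij.
  apply: eq_bigr => k _.
  by rewrite !mxE; case: eqP; rewrite ?mulr1 ?mulr0.
have Vmul m (M : 'M[R]_(#|C|, m)) i j :
    (V *m M) i j = M (enum_rank (s (enum_val i))) j.
  rewrite mxE (bigD1 (enum_rank (s (enum_val i)))) //= mxE enum_rankK eqxx.
  rewrite mul1r big1 ?addr0 // => k; rewrite mxE => ki.
  by case: (s _ =P _) ki => [->|]; rewrite ?enum_valK ?eqxx ?mul0r.
rewrite (@det_block_invariant _ _ _ _ _ V); last first.
  apply/matrixP => i j; rewrite Vmul [LHS]mxE [RHS]mxE.
  rewrite (mulV _ (fun i e => F (inr (enum_val i)) (inr e))).
  rewrite (mulV _ (fun i e => F (inl (enum_val i)) (inr e))).
  by rewrite !mxE enum_rankK.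
congr (_ * _); congr (\det _); apply/matrixP => i j.
  rewrite [LHS]mxE (mulV _ (fun i e => F (inl (enum_val i)) (inr e))).
  by rewrite !mxE.
by rewrite [LHS]mxE [X in _ + X]mxE Vmul !mxE enum_rankK.
Qed.

(** The matrix is block diagonal with [#|I|] copies of [B]; induction peels off one block at a
    time. *)
Lemma fdet_kron_id (I K : finType) (B : K -> K -> R) :
  fdet (fun x y : I * K => B x.2 y.2 *+ (x.1 == y.1)) = fdet B ^+ #|I|.
Proof.
pose h (x : 'I_#|I| * K) := (enum_val x.1, x.2) : I * K.
rewrite (@fdet_reindex _ _ h); last first.
  exists (fun y => (enum_rank y.1, y.2)) => -[i k];
    by rewrite /h /= ?enum_valK ?enum_rankK.
rewrite (eq_fdet (F' := fun x y => B x.2 y.2 *+ (x.1 == y.1))); last first.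
  by move=> x y; rewrite (inj_eq enum_val_inj).
move: #|I| => n {h}; elim: n => [|n IHn].
  rewrite /fdet expr0; move: (\matrix_(_, _) _).
  by rewrite card_prod card_ord => M; rewrite det_mx00.
pose h (x : K + 'I_n * K) : 'I_n.+1 * K :=
  match x with inl k => (ord0, k) | inr y => (lift ord0 y.1, y.2) end.
rewrite (@fdet_reindex _ _ h); last first.
  exists (fun y => if unlift ord0 y.1 is Some i then inr (i, y.2) else inl y.2).
    by case=> [k|[i k]]; rewrite /h /= ?unlift_none ?liftK.
  by case=> i k /=; case: unliftP => [j|] -> /=.
rewrite fdet_sum exprS -IHn.
set Y := (X in block_mx _ X _ _); have -> : Y = 0.
  by apply/matrixP => i j; rewrite !mxE.
by rewrite det_lblock; congr (_ * _).
Qed.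

End FinDet.

(** * Interchangeable blocks and interchangeable single indices *)

Section Copies.
Variables (R : comNzRingType) (K0 K1 J : finType).
Variables (P : K0 -> K0 -> R) (Q : K0 -> K1 -> R) (S : K1 -> K0 -> R).
Variables A B : K1 -> K1 -> R.

(* One copy of [K0] and [#|J|] interchangeable copies of [K1]. *)
Definition copies_mx (x y : K0 + J * K1) : R :=
  match x, y with
  | inl k, inl l => P k l
  | inl k, inr (_, l) => Q k l
  | inr (_, k), inl l => S k l
  | inr (i, k), inr (j, l) => A k l + B k l *+ (i == j)
  end.

(** Columns of the merged copies are summed: [Q] and [A] occur once per copy, whereas [B] occurs
    only in the matching copy. *)
Definition copies_quotient (x y : K0 + K1) : R :=
  match x, y with
  | inl k, inl l => P k l
  | inl k, inr l => Q k l *+ #|J|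
  | inr k, inl l => S k l
  | inr k, inr l => A k l *+ #|J| + B k l
  end.

(** Copy [i0] represents all copies. Subtracting its rows from those of another copy cancels [A] and
    leaves a block diagonal matrix of [#|J| - 1] blocks [B]. *)
Lemma fdet_copies (i0 : J) :
  fdet copies_mx = fdet copies_quotient * fdet B ^+ (#|J| - 1).
Proof.
pose E : finType := {i : J | i != i0}.
have cardJ : #|J| = #|E|.+1.
  have -> : #|E| = #|predC1 i0| by rewrite card_sig; apply: eq_card.
  rewrite cardC1 prednK //.
  by apply/card_gt0P; exists i0.
pose h (x : (K0 + K1) + E * K1) : K0 + J * K1 :=
  match x with
  | inl (inl k) => inl k
  | inl (inr k) => inr (i0, k)
  | inr (e, k) => inr (val e, k)
  end.
rewrite (@fdet_reindex _ _ _ h); last first.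
  exists (fun x => match x with
    | inl k => inl (inl k)
    | inr (i, k) => if insub i is Some e then inr (e, k) else inl (inr k)
    end).
    case=> [[k|k]|[e k]] //=; last by rewrite valK.
    by rewrite insubN // negbK.
  case=> [k|[i k]] //=; case: insubP => [e _ <- //|].
  by rewrite negbK => /eqP ->.
have sumr (G : E * K1 -> R) l :
    \sum_(x : E * K1 | @inr K0 K1 x.2 == inr l) G x = \sum_e G (e, l).
  rewrite (eq_big (fun x => xpredT x.1 && pred1 l x.2)
                  (fun x => G (x.1, x.2))) //; last by case.
  rewrite -(pair_big xpredT (pred1 l) (fun e k => G (e, k))) /=.
  by apply: eq_bigr => e _; rewrite big_pred1_eq.
rewrite (@fdet_quotient _ _ _ (fun x => inr x.2)); last first.
  case=> e k [] l /=; first by rewrite !big_pred0.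
  rewrite !sumr /= eqxx (negbTE (valP e)) addr0 big_split /= -!addrA.
  congr (_ + _); rewrite addrC; congr (_ + _); last first.
    by apply: eq_bigr => e' _; rewrite eq_sym (negbTE (valP e')) addr0.
  rewrite (bigD1 e) //= eqxx big1 ?addr0 // => e' e'e.
  by rewrite (inj_eq val_inj) eq_sym (negbTE e'e).
congr (_ * _).
  apply: eq_fdet => -[] k [] l /=.
  - by rewrite big_pred0 ?addr0.
  - by rewrite sumr /= sumr_const cardJ mulrS.
  - by rewrite big_pred0 ?addr0.
  rewrite sumr /= eqxx mulr1n cardJ mulrS addrAC; congr (_ + _ + _).
  rewrite -sumr_const; apply: eq_bigr => e _.
  by rewrite eq_sym (negbTE (valP e)) addr0.
rewrite cardJ subn1 /= -fdet_kron_id; apply: eq_fdet => -[e k] [e' k'] /=.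
by rewrite [i0 == _]eq_sym (negbTE (valP e')) addr0 addrC addKr.
Qed.

End Copies.

(** Rows with the same class differ only in their [y] entries, so on the indices that are not
    representatives the complement is the scalar matrix [y]. *)
Lemma fdet_twins (R : comNzRingType) (T C : finType) (cl : T -> C)
    (rep : C -> T) (y : R) (M : C -> C -> R) :
  cancel rep cl ->
  fdet (fun s t => y *+ (s == t) - M (cl s) (cl t)) =
  fdet (fun c d => y *+ (c == d) - M c d *+ #|[set t | cl t == d]|)
  * y ^+ (#|T| - #|C|).
Proof.
move=> repK; pose E : finType := {t : T | rep (cl t) != t}.
pose h (x : C + E) : T := match x with inl c => rep c | inr e => val e end.
have bij_h : bijective h.
  exists (fun t => if insub t is Some e then inr e else inl (cl t)).
    by case=> [c|e] /=; [rewrite insubN ?repK ?negbK // repK | rewrite valK].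
  by move=> t; case: insubP => [e _ <- //|]; rewrite negbK => /eqP.
have cardE : #|E| = (#|T| - #|C|)%N.
  by rewrite -(bij_eq_card bij_h) card_sum addKn.
have repE c (e : E) : (rep c == val e) = false.
  by apply/negbTE/eqP => re; have := valP e; rewrite -re repK eqxx.
have sumE d (G : T -> R) :
    G (rep d) + \sum_(e : E | cl (val e) == d) G (val e) =
    \sum_(t | cl t == d) G t.
  rewrite (reindex h) /=; last exact/onW_bij.
  rewrite big_sumType /=; congr (_ + _).
  by rewrite (eq_bigl (pred1 d)) ?big_pred1_eq // => c; rewrite /= repK.
have sumM s d : \sum_(t | cl t == d) (y *+ (s == t) - M (cl s) (cl t)) =
    y *+ (cl s == d) - M (cl s) d *+ #|[set t | cl t == d]|.
  rewrite big_split /=; congr (_ + _).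
    have [sd|sd] := altP eqP.
      rewrite (bigD1 s) ?sd //= eqxx big1 ?addr0 // => t /andP[_ ts].
      by rewrite eq_sym (negbTE ts).
    rewrite big1 // => t td; case: eqP => // st.
    by rewrite st td in sd.
  rewrite -mulNrn -sumr_const; apply: eq_big => [t|t /eqP -> //].
  by rewrite inE.
rewrite (fdet_reindex _ bij_h) (@fdet_quotient _ _ _ (fun e => cl (val e))).
  congr (_ * _).
    apply: eq_fdet => c d.
    by rewrite (sumE d (fun t => y *+ (rep c == t) - M (cl (rep c)) (cl t)))
      sumM repK.
  rewrite -cardE -fdet_scalar; apply: eq_fdet => e e' /=.
  by rewrite repE repK mulr0n sub0r opprK subrK.
move=> e d /=.
rewrite (sumE d (fun t => y *+ (val e == t) - M (cl (val e)) (cl t))).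
rewrite (sumE d (fun t => y *+ (_ == t) - M (cl (rep _)) (cl t))).
by rewrite !sumM repK.
Qed.

(* An elementary abelian p-group is coded by [option I]: [None] is the identity
   and [I] is the set of subgroups of order p; [ole] is then inclusion of the
   generated cyclic subgroups. *)
Definition ole (I : eqType) (a b : option I) : bool := (a == None) || (a == b).

(** With [u] equal to p - 1, this counts the generators of the cyclic subgroup coded by [a]. *)
Definition osize (I : Type) (u : nat) (a : option I) : nat :=
  if a is Some _ then u else 1.

(** The value is 1 also for [c = d], since distinct generators of one subgroup are adjacent. *)
Definition class_dist (I J : eqType) (c d : option I * option J) : nat :=
  if (ole c.1 d.1 && ole c.2 d.2) || (ole d.1 c.1 && ole d.2 c.2) then 1 else 2.

(** * Splitting over the subgroups of order p, then over those of order q *)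

Section ClassDet.
Variables (R : comNzRingType) (y : R) (u v : nat) (I J : finType).

Definition class_mx (c d : option I * option J) : R :=
  y *+ (c == d) - (class_dist c d)%:R *+ (osize u d.1 * osize v d.2).

(* Blocks of [class_mx] by whether the first component is [None] (0) or
   [Some i] (1); in the last case [class11_diag] is what the equality of the
   two indices [i] contributes on top of [class11_off]. *)
Definition class00 (j k : option J) : R :=
  y *+ (j == k) - (if ole j k || ole k j then 1%N else 2)%:R *+ osize v k.
Definition class01 (j k : option J) : R :=
  - (if ole j k then 1%N else 2)%:R *+ (u * osize v k).
Definition class10 (j k : option J) : R :=
  - (if ole k j then 1%N else 2)%:R *+ osize v k.
Definition class11_off (j k : option J) : R := - 2%:R *+ (u * osize v k).
Definition class11_diag (j k : option J) : R :=
  y *+ (j == k) + (ole j k || ole k j)%:R *+ (u * osize v k).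

Definition class_quotient :=
  copies_quotient I class00 class01 class10 class11_off class11_diag.

(** Pairs with different subgroups of order p in the first component are never comparable, so their
    distance is always 2 and these subgroups are interchangeable. *)
Lemma fdet_class_blocks (i0 : I) :
  fdet class_mx = fdet class_quotient * fdet class11_diag ^+ (#|I| - 1).
Proof.
rewrite -fdet_copies //.
pose h (x : option J + I * option J) : option I * option J :=
  match x with inl j => (None, j) | inr (i, j) => (Some i, j) end.
rewrite (@fdet_reindex _ _ _ h); last first.
  exists (fun x => if x.1 is Some i then inr (i, x.2) else inl x.2);
    by [case=> [j|[i j]] | case=> [[i|] j]].
apply: eq_fdet => x z; rewrite /class_mx.
have -> : (h x == h z) = (x == z).
  apply/eqP/eqP => [|-> //]; case: x z => [j|[i j]] [k|[i' k]] //= [];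
    by [move=> -> | move=> -> ->].
rewrite /class_dist.
case: x z => [j|[i j]] [k|[i' k]]; rewrite /h /copies_mx /ole /= ?mul1n //.
- by rewrite /class01 /ole orbF mulr0n sub0r mulNrn.
- by rewrite /class10 /ole mulr0n sub0r mulNrn.
rewrite /class11_off /class11_diag /ole !(inj_eq Some_inj) [i' == i]eq_sym.
rewrite -[inr _ == inr _]/((i, j) == (i', k)) xpair_eqE.
have [_|_] /= := eqVneq i i'; last by rewrite mulr0n addr0 sub0r mulNrn.
by case: (_ || _) => /=; ring.
Qed.

(** Inside one block the subgroups of order q are interchangeable single indices. The 2 by 2
    determinant becomes f, and the other factor becomes x + (p-1)(q-1) + 1. *)
Lemma fdet_class11_diag (j0 : J) :
  fdet class11_diag = \det (\matrix_(i < 2, j < 2) nth 0 (nth [::]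
     [:: [:: y + u%:R; u%:R * v%:R * #|J|%:R]; [:: u%:R; y + u%:R * v%:R]] i) j)
   * (y + u%:R * v%:R) ^+ (#|J| - 1).
Proof.
pose h (x : unit + J * unit) : option J :=
  match x with inl _ => None | inr (j, _) => Some j end.
have bij_h : bijective h.
  exists (fun x => if x is Some j then inr (j, tt) else inl tt);
    by [case=> [[]|[j []]] | case].
pose P (_ _ : unit) := y + u%:R; pose Q (_ _ : unit) := u%:R * v%:R : R.
pose S (_ _ : unit) := u%:R : R; pose A (_ _ : unit) := 0 : R.
pose B (_ _ : unit) := y + u%:R * v%:R.
rewrite (fdet_reindex _ bij_h) (eq_fdet (F' := copies_mx P Q S A B)).
  rewrite (fdet_copies _ _ _ _ _ j0); congr (_ * _).
    pose g (i : 'I_2) : unit + unit := if i == ord0 then inl tt else inr tt.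
    rewrite (@fdet_ord _ _ _ g); last first.
      exists (fun x => if x is inl _ then ord0 else ord_max);
        by [case=> [[|[|]]] // ?; apply/val_inj | case=> [[]|[]]].
    congr (\det _); apply/matrixP => i j; rewrite !mxE.
    by case: i j => [[|[|]] //= ?] [[|[|]] //= ?];
      rewrite /P /Q /S /A /B /=; ring.
  congr (_ ^+ _).
  rewrite (@fdet_ord _ _ 1%N (fun=> tt)); last first.
    by exists (fun=> ord0) => [i|[]]; rewrite ?ord1.
  by rewrite det_mx11 mxE.
case=> [[]|[j []]] [[]|[k []]]; rewrite /h /class11_diag /copies_mx /ole /P /Q /S /A /B /=.
- by ring.
- by ring.
- by ring.
rewrite !(inj_eq Some_inj) [k == j]eq_sym.
by case: eqVneq => _ /=; ring.
Qed.

(** The 4 by 4 determinant becomes that of [T1D], and the 2 by 2 one becomes g. *)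
Lemma fdet_class_quotient (j0 : J) (a := #|I|%:R : R) (b := #|J|%:R : R)
    (s := u%:R : R) (t := v%:R : R) :
  fdet class_quotient = \det (\matrix_(i < 4, j < 4) nth 0 (nth [::]
   [:: [:: y - 1; - (s * a); - (s * t * a * b); - (t * b)];
       [:: - 1; y + s - 2 * s * a; (s * t - 2 * s * t * a) * b; - (2 * t * b)];
       [:: - 1; s - 2 * s * a; y + s * t - 2 * s * t * a * b; t - 2 * t * b];
       [:: - 1; - (2 * s * a); s * t * a - 2 * s * t * a * b; y + t - 2 * t * b]]
    i) j)
   * \det (\matrix_(i < 2, j < 2) nth 0 (nth [::]
     [:: [:: y + s * t; t]; [:: s * t * a; y + t]] i) j) ^+ (#|J| - 1).
Proof.
(* Each subgroup of order q occurs twice: with the trivial p-part ([false]) and with the merged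
   subgroups of order p ([true]). *)
pose h (x : bool + J * bool) : option J + option J :=
  match x with
  | inl c => if c then inr None else inl None
  | inr (j, c) => if c then inr (Some j) else inl (Some j)
  end.
have bij_h : bijective h.
  exists (fun x => match x with
     | inl None => inl false | inr None => inl true
     | inl (Some j) => inr (j, false) | inr (Some j) => inr (j, true) end).
    by case=> [[]|[j []]].
  by case=> [[]|[]].
pose P (c d : bool) := if c then if d then y + s - 2 * s * a else - 1
  else if d then - (s * a) else y - 1.
pose Q (c d : bool) := if c then if d then s * t - 2 * s * t * a else - (2 * t)
  else if d then - (s * t * a) else - t.
pose S (c d : bool) := if c then if d then s - 2 * s * a else - 1
  else if d then - (2 * s * a) else - 1.
pose A (c d : bool) := if d then - (2 * s * t * a) else - (2 * t).
pose B (c d : bool) := if c then if d then y + s * t else t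
  else if d then s * t * a else y + t.
rewrite (fdet_reindex _ bij_h) (eq_fdet (F' := copies_mx P Q S A B)).
  rewrite (fdet_copies _ _ _ _ _ j0); congr (_ * _).
    (* The order is that of [T1D]: element orders 1, p, pq, q. *)
    pose g (i : 'I_4) : bool + bool :=
      nth (inl false) [:: inl false; inl true; inr true; inr false] i.
    have bij_g : bijective g.
      exists (fun x => inord (match x with inl false => 0 | inl true => 1
                              | inr true => 2 | inr false => 3 end)).
        by case=> [[|[|[|[|]]]]] // ?; apply/val_inj; rewrite /= inordK.
      by case=> [[]|[]]; rewrite /g inordK.
    rewrite (fdet_ord _ bij_g).
    congr (\det _); apply/matrixP => i j; rewrite !mxE.
    by case: i j => [[|[|[|[|]]]] //= ?] [[|[|[|[|]]]] //= ?];
      rewrite /g /P /Q /S /A /B /=; ring.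
  congr (_ ^+ _).
  pose g (i : 'I_2) : bool := i == ord0.
  rewrite (@fdet_ord _ _ _ g); last first.
    exists (fun x : bool => if x then ord0 else ord_max);
      by [case=> [[|[|]]] // ?; apply/val_inj | case=> []].
  congr (\det _); apply/matrixP => i j; rewrite !mxE.
  by case: i j => [[|[|]] //= ?] [[|[|]] //= ?].
case=> [[]|[j []]] [[]|[k []]]; rewrite /h /class_quotient /copies_quotient /copies_mx;
  rewrite /class00 /class01 /class10 /class11_off /class11_diag /ole /P /Q /S /A /B /= ?eqxx /=;
  rewrite ?(inj_eq Some_inj) ?[k == j]eq_sym; try (case: (eqVneq j k) => _ /=).
all: rewrite /a /s /t; ring.
Qed.

End ClassDet.

(** * Distances in the power graph and cyclic subgroups *)

Lemma power_graphE (gT : finGroupType) (a b : gT) :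
  power_graph a b = (a != b) && ((a \in <[b]>) || (b \in <[a]>))%g.
Proof.
(* Edges require a positive exponent, so exponent 0 is replaced by the order of [y]. *)
have posP (x y : gT) : (x \in <[y]>)%g -> exists k, (0 < k)%N /\ x = (y ^+ k)%g.
  case/cycleP=> [[|k]] ->; last by exists k.+1.
  by exists #[y]%g; rewrite order_gt0 expg_order expg0.
apply/power_graphP/andP => [[/eqP ab [k [_ ak]]]|[/eqP ab /orP[] /posP[k [k0 bk]]]].
- by split=> //; case: ak => ->; rewrite mem_cycle ?orbT.
- by split=> //; exists k; split=> //; left.
- by split=> //; exists k; split=> //; right.
Qed.

(** The identity is adjacent to every other element, so no distance exceeds 2. *)
Lemma gdist_power_graph (gT : finGroupType) (a b : gT) :
  gdist (@power_graph gT) a b =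
  if a == b then 0%N
  else if ((a \in <[b]>) || (b \in <[a]>))%g then 1%N else 2.
Proof.
have [<-|ab] := eqVneq a b.
  by apply/eqP; rewrite -leqn0; apply: (@gdist_le _ _ a [::]).
have := gdist_walk (power_graph_connected a b).
have d2 : (gdist (@power_graph gT) a b <= 2)%N.
  have [->|a1] := eqVneq a 1%g.
    have [->|b1] := eqVneq b 1%g.
      by apply: (@leq_trans 0) => //; apply: (@gdist_le _ _ 1%g [::]).
    apply: (@leq_trans 1) => //; apply: (@gdist_le _ _ 1%g [:: b]).
    by rewrite /= power_graphE eq_sym b1 group1.
  have [->|b1] := eqVneq b 1%g.
    apply: (@leq_trans 1) => //; apply: (@gdist_le _ _ a [:: 1%g]).
    by rewrite /= power_graphE a1 group1 orbT.
  apply: (@gdist_le _ _ a [:: 1%g; b]).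
  by rewrite /= !power_graphE a1 [_ == b]eq_sym b1 !group1 orbT.
have [adj|nadj] := boolP (_ || _).
  have d1 : (gdist (@power_graph gT) a b <= 1)%N.
    by apply: (@gdist_le _ _ a [:: b]); rewrite /= power_graphE ab adj.
  move/has_walkP=> [w [_ lw sw]]; case: gdist d1 sw => [|[]] // _ /size0nil w0.
  by rewrite w0 /= in lw; rewrite lw eqxx in ab.
move/has_walkP=> [w [pw lw sw]]; case: gdist d2 sw => [|[|[]]] // _.
  by move/size0nil=> w0; rewrite w0 /= in lw; rewrite lw eqxx in ab.
case: w pw lw => [|c []] //= + cb _.
by rewrite cb power_graphE (negbTE nadj) andbF.
Qed.

Lemma expg_pair (gA gB : finGroupType) (a : gA) (b : gB) k :
  (((a, b) : gA * gB) ^+ k = (a ^+ k, b ^+ k))%g.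
Proof. by elim: k => // k IHk; rewrite !expgS IHk. Qed.

(** Coprime orders let the Chinese remainder theorem merge the two exponents into one. *)
Lemma mem_cycle_pair (gA gB : finGroupType) (x y : gA * gB) :
  coprime #|gA| #|gB| ->
  (x \in <[y]>)%g = (x.1 \in <[y.1]>)%g && (x.2 \in <[y.2]>)%g.
Proof.
case: x y => [a b] [a' b'] /= co.
have co' : coprime #[a']%g #[b']%g.
  apply: coprime_dvdl (coprime_dvdr _ co); rewrite -cardsT;
    by apply: order_dvdG; rewrite inE.
apply/cycleP/andP => [[k]|[/cycleP[i ->] /cycleP[j ->]]].
  by rewrite expg_pair => -[-> ->]; rewrite !mem_cycle.
exists (chinese #[a']%g #[b']%g i j); rewrite expg_pair; congr pair; apply/eqP.
  by rewrite eq_expg_mod_order chinese_modl.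
by rewrite eq_expg_mod_order chinese_modr.
Qed.

(** Nonidentity elements have order p, so the subgroups of order p partition them into sets of p - 1
    generators. *)
Lemma El_classes (p n : nat) (gT : finGroupType) :
  prime p -> is_El p n gT ->
  exists (I : finType) (cl : gT -> option I) (rep : option I -> gT),
  [/\ cancel rep cl, forall a b, (a \in <[b]>)%g = ole (cl a) (cl b),
      forall c, #|[set a | cl a == c]| = osize (p - 1) c
    & (#|I| * (p - 1)).+1 = (p ^ n)%N].
Proof.
move=> p_pr [abel card_gT].
have ordp (a : gT) : a != 1%g -> #[a]%g = p.
  by apply: abelem_order_p abel _; rewrite inE.
have cycE (a b : gT) : a != 1%g -> (a \in <[b]>)%g = (<[a]> == <[b]>)%g.
  move=> a1; apply/idP/eqP => [ab|<-]; last exact: cycle_id.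
  have b1 : b != 1%g.
    by apply: contraNneq a1 => b1; rewrite b1 cycle1 inE in ab.
  apply/eqP; rewrite eqEcard cycle_subG ab /=.
  by rewrite -!orderE !ordp.
pose I : finType :=
  {H : {set gT} | (H != 1%g) && [exists a, H == <[a]>%g]}.
pose cl (a : gT) : option I := insub <[a]>%g.
(* The default of [odflt] is never reached, because every member of [I] has a generator. *)
pose rep (c : option I) : gT :=
  if c is Some H then odflt 1%g [pick a | <[a]>%g == val H] else 1%g.
have cl1 : cl 1%g = None by rewrite /cl cycle1 insubN ?eqxx.
have clS (a : gT) : a != 1%g -> exists2 H, cl a = Some H & val H = <[a]>%g.
  move=> a1; rewrite /cl; case: insubP => [H _ <-|]; first by exists H.
  by rewrite cycle_eq1 a1 /= => /existsP[]; exists a.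
have clN a : (cl a == None) = (a == 1%g).
  by have [->|/clS[H -> _]] := eqVneq a 1%g; rewrite ?cl1.
have clE a b : a != 1%g -> (cl a == cl b) = (<[a]> == <[b]>)%g.
  move=> a1; have [H -> HE] := clS a a1.
  have [->|/clS[K -> KE]] := eqVneq b 1%g.
    by rewrite cl1 cycle1 cycle_eq1 (negbTE a1).
  by rewrite -HE -KE.
have repK : cancel rep cl.
  case=> [H|] //=; have /andP[H1 /existsP[a /eqP Ha]] := valP H.
  case: pickP => [b /eqP bH|/(_ a)] /=; last by rewrite -Ha eqxx.
  by rewrite /cl bH valK.
have fib c : #|[set a | cl a == c]| = osize (p - 1) c.
  case: c => [H|] /=; last first.
    by rewrite -(cards1 (1%g : gT)); apply: eq_card => a; rewrite !inE clN.
  have /eqP rH := repK (Some H); set g := rep _ in rH.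
  have g1 : g != 1%g by rewrite -clN (eqP rH).
  rewrite -(ordp g g1) orderE (cardsD1 1%g <[g]>%g) group1 add1n subn1 /=.
  apply: eq_card => a; rewrite !inE -(eqP rH).
  have [->|a1] /= := eqVneq a 1%g; first by rewrite cl1 eq_sym clN (negbTE g1).
  by rewrite clE // cycE.
exists I, cl, rep; split=> //.
  move=> a b; rewrite /ole clN; have [->|a1] /= := eqVneq a 1%g.
    by rewrite group1.
  by rewrite cycE // clE.
rewrite -card_gT -[RHS]sum1_card (partition_big cl xpredT) //= (bigD1 None) //=.
have sumc c : (\sum_(a | cl a == c) 1)%N = osize (p - 1) c.
  by rewrite sum1_card -fib; apply: eq_card => a; rewrite inE.
rewrite sumc add1n; congr _.+1.
rewrite (eq_bigr (fun=> (p - 1)%N)) => [|[H|] // _].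
by rewrite sum_nat_const cardC1 card_option.
Qed.

(** * The characteristic polynomial of the distance matrix *)

Lemma char_poly_rows k (rows : seq (seq int)) (M : 'M[{poly int}]_k) :
  (forall i j : 'I_k,
     M i j = 'X *+ (i == j) - (nth 0 (nth [::] rows i) j)%:P) ->
  char_poly (mx_of_rows k k rows) = \det M.
Proof.
by move=> ME; congr (\det _); apply/matrixP => i j; rewrite !mxE ME.
Qed.

Theorem theorem4p10 (p q n m : nat) (gA gB : finGroupType)
  (hp : prime p) (hq : prime q) (hpq : p <> q)
  (hn : (0 < n)%N) (hm : (0 < m)%N)
  (hA : is_El p n gA) (hB : is_El q m gB) :
  let G : finGroupType := (gA * gB)%type in
  let alpha := ((p ^ n - 1) %/ (p - 1))%N in
  let beta := ((q ^ m - 1) %/ (q - 1))%N in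
  let f := char_poly (fmx p q m) in
  let g := char_poly (gmx p q n) in
  char_poly (distance_mx (@power_graph G)) =
    char_poly (T1D p q n m)
    * ('X + 1) ^+ (p ^ n * q ^ m - (alpha + 1) * (beta + 1))%N
    * ('X + ((p%:Z - 1) * (q%:Z - 1) + 1)%:P) ^+ ((alpha - 1) * (beta - 1))%N
    * f ^+ (alpha - 1)%N * g ^+ (beta - 1)%N.
Proof.
move=> G alpha beta f g.
have [I [clA [repA [repAK memA fibA cardI]]]] := El_classes hp hA.
have [J [clB [repB [repBK memB fibB cardJ]]]] := El_classes hq hB.
have co : coprime #|gA| #|gB|.
  by rewrite hA.2 hB.2 coprimeXl // coprimeXr // prime_coprime // dvdn_prime2 //;
    apply/eqP.
have aE : alpha = #|I|.
  by rewrite /alpha -cardI subn1 mulnK // subn_gt0 prime_gt1.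
have bE : beta = #|J|.
  by rewrite /beta -cardJ subn1 mulnK // subn_gt0 prime_gt1.
have gt1 r k : prime r -> (0 < k)%N -> (1 < r ^ k)%N.
  by move=> r_pr k0; rewrite -(exp1n k) ltn_exp2r ?prime_gt1.
have [i0 _] : exists i0, i0 \in I.
  by apply/card_gt0P; have := gt1 p n hp hn; rewrite -cardI; case: #|I|.
have [j0 _] : exists j0, j0 \in J.
  by apply/card_gt0P; have := gt1 q m hq hm; rewrite -cardJ; case: #|J|.
pose cl (x : G) := (clA x.1, clB x.2).
pose rep c : G := (repA c.1, repB c.2).
have repK : cancel rep cl by case=> c d; rewrite /cl /rep /= repAK repBK.
have natP k : k%:R = (k%:Z)%:P :> {poly int} by rewrite -natz polyC_natr.
(* On the diagonal the distance is 0 but [class_dist] is 1; the shift by 1 compensates. *)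
pose y : {poly int} := 'X + 1.
have -> : char_poly (distance_mx (@power_graph G)) =
    fdet (fun s t : G => y *+ (s == t) - (class_dist (cl s) (cl t))%:R).
  congr (\det _); apply/matrixP => i j; rewrite !mxE.
  rewrite gdist_power_graph !mem_cycle_pair // !memA !memB.
  rewrite /class_dist /= -(inj_eq enum_val_inj) natP.
  have [->|_] := eqVneq (enum_val i) (enum_val j).
    by rewrite /ole !eqxx !orbT /y /=; ring.
  by rewrite !mulr0n.
rewrite (fdet_twins y (fun c d => (class_dist c d)%:R) repK).
rewrite (eq_fdet (F' := @class_mx _ y (p - 1) (q - 1) I J)); last first.
  move=> c d; rewrite /class_mx -fibA -fibB -cardsX; congr (_ - _ *+ _).
  by apply: eq_card => x; rewrite !inE.
rewrite fdet_class_blocks // fdet_class11_diag // fdet_class_quotient //.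
(* With p - 1, q - 1 and the numbers of subgroups as the only parameters, the small matrices agree
   entrywise by [ring]. *)
have pE : p%:Z = (p - 1)%N%:Z + 1.
  by rewrite -PoszD subnK ?prime_gt0.
have qE : q%:Z = (q - 1)%N%:Z + 1.
  by rewrite -PoszD subnK ?prime_gt0.
have pnE : p%:Z ^+ n = #|I|%:Z * (p - 1)%N%:Z + 1.
  by rewrite -PoszM -PoszD addn1 cardI -[RHS]natz natrX natz.
have qmE : q%:Z ^+ m = #|J|%:Z * (q - 1)%N%:Z + 1.
  by rewrite -PoszM -PoszD addn1 cardJ -[RHS]natz natrX natz.
rewrite !natP.
set T := \det _; set gg := \det _; set ff := \det _.
have -> : char_poly (T1D p q n m) = T.
  apply: char_poly_rows => i j; rewrite !mxE pnE qmE pE qE /y.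
  by case: i j => [[|[|[|[|]]]] //= ?] [[|[|[|[|]]]] //= ?]; ring.
have -> : f = ff.
  apply: char_poly_rows => i j; rewrite !mxE qmE pE qE /y.
  by case: i j => [[|[|]] //= ?] [[|[|]] //= ?]; ring.
have -> : g = gg.
  apply: char_poly_rows => i j; rewrite !mxE pnE pE qE /y.
  by case: i j => [[|[|]] //= ?] [[|[|]] //= ?]; ring.
have -> : 'X + ((p%:Z - 1) * (q%:Z - 1) + 1)%:P =
    y + (p - 1)%N%:Z%:P * (q - 1)%N%:Z%:P.
  by rewrite pE qE /y; ring.
rewrite !card_prod !card_option hA.2 hB.2 aE bE !addn1 exprMn -exprM.
rewrite [((#|I| - 1) * _)%N]mulnC.
by ring.
Qed.
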